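(* Let $A_\Gamma$ be an Artin group such that there exists a prime $p$ with $p\mid \frac{l(e)}{2}$ for every edge $e$ of $\Gamma$ with even label $l(e)>2$. Then for every nonzero character $\chi:A_\Gamma\to\mathbb{R}$, $[\chi]\in\Sigma^1(A_\Gamma,\mathbb{Z})$ if and only if $\mathrm{Liv}^\chi$ is connected and dominant.
   Context: $\Gamma$ is a finite simple graph with edge labels $l(e)\in\mathbb{Z}_{\ge2}$; $A_\Gamma=\langle V(\Gamma)\mid \langle u,v\rangle^{l(e)}=\langle v,u\rangle^{l(e)}\ \forall e=\{u,v\}\in E(\Gamma)\rangle$, $\langle u,v\rangle^m$ the alternating word $uvu\cdots$ of length $m$. A character is a homomorphism $\chi:A_\Gamma\to\mathbb{R}$, $[\chi]$ its class up to positive scaling. $\Sigma^1(G,\mathbb{Z})=\{[\chi]\mid\mathbb{Z}\text{ is of type }FP_1\text{ over }\mathbb{Z}G_\chi\}$ with $G_\chi=\{g\mid\chi(g)\ge0\}$. A vertex $v$ is dead if $\chi(v)=0$; an edge $e=\{u,v\}$ is dead if $l(e)>2$ is even and $\chi(u)+\chi(v)=0$. The living subgraph $\mathrm{Liv}^\chi$ is obtained from $\Gamma$ by removing all dead vertices (with incident edges) and the interiors of all dead edges. It is dominant if every vertex of $\Gamma$ not in $\mathrm{Liv}^\chi$ is adjacent in $\Gamma$ to some vertex of $\mathrm{Liv}^\chi$. *)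

(* Defs.v *)
From HB Require Import structures.
From mathcomp Require Import all_boot all_order all_algebra.
From mathcomp Require Import boolp reals.
Set Implicit Arguments. Unset Strict Implicit. Unset Printing Implicit Defensive.
Import Order.TTheory GRing.Theory Num.Theory.
Local Open Scope ring_scope.

(* A labelled finite simple graph Gamma is given by a vertex type V : finType,
   a symmetric irreflexive adjacency relation adj : rel V and labels lab u v
   (only meaningful when adj u v). *)

Section Artin.
Variables (V : finType) (adj : rel V) (lab : V -> V -> nat).

(* Words in the free group on V: (v, true) = v, (v, false) = v^-1. *)
Definition word := seq (V * bool).

Fixpoint alt (u v : V) (m : nat) : word :=
  if m is m'.+1 then (u, true) :: alt v u m' else [::].

(* The congruence on words whose quotient is the Artin group A_Gamma:
   generated by free reductions and the Artin relations. *)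
Inductive artin_eq : word -> word -> Prop :=
| ae_refl w : artin_eq w w
| ae_sym w1 w2 : artin_eq w1 w2 -> artin_eq w2 w1
| ae_trans w1 w2 w3 : artin_eq w1 w2 -> artin_eq w2 w3 -> artin_eq w1 w3
| ae_free a b v s : artin_eq (a ++ (v, s) :: (v, ~~ s) :: b) (a ++ b)
| ae_rel a b u v : adj u v ->
    artin_eq (a ++ alt u v (lab u v) ++ b) (a ++ alt v u (lab u v) ++ b).

Variable R : realType.

Definition is_character (chi : word -> R) : Prop :=
  (forall w1 w2, artin_eq w1 w2 -> chi w1 = chi w2) /\
  (forall w1 w2, chi (w1 ++ w2) = chi w1 + chi w2).

Definition chiv (chi : word -> R) (v : V) : R := chi [:: (v, true)].

(* Elements of Z A_Gamma as formal finite Z-combinations of words. *)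
Definition fsum := seq (int * word).

Definition coef (c : fsum) (g : word) : int :=
  \sum_(p <- c) (if `[< artin_eq p.2 g >] then p.1 else 0).

Definition eqR (c1 c2 : fsum) : Prop := forall g, coef c1 g = coef c2 g.

Definition mulF (c1 c2 : fsum) : fsum :=
  [seq ((p.1 * q.1)%R, p.2 ++ q.2) | p <- c1, q <- c2].

Definition aug (c : fsum) : int := \sum_(p <- c) p.1.

Definition inG (chi : word -> R) (c : fsum) : bool :=
  all (fun p => 0 <= chi p.2) c.

(* Z (trivial module) is of type FP_1 over Z[G_chi]: there is an exact
   sequence  F_1 --d1--> F_0 --d0--> Z --> 0  of left Z[G_chi]-modules with
   F_0 = Z[G_chi]^n, F_1 = Z[G_chi]^m finitely generated free;
   d0 x = sum_i aug(x_i) z_i, d1 y = y M (M an m x n matrix over Z[G_chi]). *)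
Definition FP1_trivial (chi : word -> R) : Prop :=
  exists (n : nat) (z : 'I_n -> int) (m : nat) (M : 'I_m -> 'I_n -> fsum),
    (forall j i, inG chi (M j i)) /\
    (forall k : int, exists x : 'I_n -> fsum,
        (forall i, inG chi (x i)) /\ \sum_(i < n) aug (x i) * z i = k) /\
    (forall x : 'I_n -> fsum, (forall i, inG chi (x i)) ->
       (\sum_(i < n) aug (x i) * z i = 0 <->
        exists y : 'I_m -> fsum, (forall j, inG chi (y j)) /\
          forall i, eqR (x i) (\big[cat/[::]]_(j < m) mulF (y j) (M j i)))).

Definition in_Sigma1 (chi : word -> R) : Prop := FP1_trivial chi.

Definition living (chi : word -> R) (v : V) : bool := chiv chi v != 0.

Definition dead_edge (chi : word -> R) (u v : V) : bool :=
  [&& adj u v, ~~ odd (lab u v), (2 < lab u v)%N & chiv chi u + chiv chi v == 0].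

Definition liv_rel (chi : word -> R) : rel V :=
  fun u v => [&& living chi u, living chi v, adj u v & ~~ dead_edge chi u v].

Definition Liv_connected (chi : word -> R) : Prop :=
  forall u v, living chi u -> living chi v -> connect (liv_rel chi) u v.

Definition Liv_dominant (chi : word -> R) : Prop :=
  forall v, ~~ living chi v -> exists u, living chi u && adj v u.

End Artin.

(* Main.v *)
(** [chi] lies in Sigma^1 iff every element of nonnegative height is reached from 1 inside the half of the Cayley
    graph of nonnegative height.

    If Liv is connected and dominant, every generator commutes with some [z] of positive height (a power of a living
    generator, or of the central element of a dihedral subgroup on a living edge), and these elements are joined to
    one positive letter [t] through positive heights: commuting elements [x], [z] are joined by first climbing along
    powers of [x].  So left multiplication by a generator moves [t] along a path that stays high, and replacing each
    letter of a word by such a path raises the minimal height of the word by a fixed amount.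

    Conversely, finite generation bounds from below the supports of a 1-cocycle with values in functions [R -> W], on
    the half where [chi >= 0].  A cocycle vanishing on a letter [b] of positive height but not on [a] contradicts this
    at [b^-n a b^n].  If Liv is disconnected, take [W = F_p] and the coboundary of the Dirac function at 0 on one
    component; its obstruction to extending over a dead edge is divisible by [p].  If the dead vertex [v0] has no
    living neighbour, take for [W] a dual reflection representation and the cocycle supported on [v0]. *)

From Stdlib Require Import Setoid Morphisms.
Require Import Defs.
From HB Require Import structures.
From mathcomp Require Import all_boot all_order all_algebra all_field.
From mathcomp Require Import boolp reals.
From mathcomp Require Import lra ring.
Set Implicit Arguments. Unset Strict Implicit. Unset Printing Implicit Defensive.
Import Order.TTheory GRing.Theory Num.Theory.
Local Open Scope ring_scope.

(** * Word calculus in the Artin group and central elements of dihedral subgroups *)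

Section ArtinCongruence.
Variables (V : finType) (adj : rel V) (lab : V -> V -> nat).
Local Notation word := (word V).
Local Notation "a =A b" := (artin_eq adj lab a b) (at level 70).

#[local] Instance artin_eq_equiv : Equivalence (artin_eq adj lab).
Proof.
by split=> [w|a b|a b c]; [apply: ae_refl|apply: ae_sym|apply: ae_trans].
Qed.

Lemma artin_eq_ctx (c e : word) a b : a =A b -> c ++ a ++ e =A c ++ b ++ e.
Proof.
elim=> {a b} [w|a b _ IH|a b f _ IH1 _ IH2|a b v s|a b u v uv].
- exact: ae_refl.
- exact: ae_sym.
- exact: ae_trans IH1 IH2.
- by have := ae_free adj lab (c ++ a) (b ++ e) v s; rewrite -!catA.
- by have := ae_rel lab (c ++ a) (b ++ e) uv; rewrite -!catA.
Qed.

#[local] Instance artin_eq_cat :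
  Proper (artin_eq adj lab ==> artin_eq adj lab ==> artin_eq adj lab) (@cat _).
Proof.
move=> a b ab c d cd; apply: (@ae_trans _ _ _ _ (b ++ c)).
  by have := artin_eq_ctx [::] c ab.
by have := artin_eq_ctx b [::] cd; rewrite !cats0.
Qed.

Definition winv (w : word) : word := rev [seq (x.1, ~~ x.2) | x <- w].

Lemma winv_cons x w : winv (x :: w) = winv w ++ [:: (x.1, ~~ x.2)].
Proof. by rewrite /winv /= rev_cons cats1. Qed.

Lemma winvK : involutive winv.
Proof.
move=> w; rewrite /winv map_rev revK -map_comp map_id_in //.
by case=> v s _ /=; rewrite negbK.
Qed.

Lemma cat_winv w : w ++ winv w =A [::].
Proof.
elim: w => [|[v s] w IH]; first exact: ae_refl.
rewrite winv_cons catA -/([:: (v, s)] ++ _) cat_cons /=.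
rewrite -[X in X =A _]/([:: (v, s)] ++ (w ++ winv w) ++ [:: (v, ~~ s)]).
rewrite IH /=; exact: (ae_free adj lab [::] [::]).
Qed.

Lemma winv_cat w : winv w ++ w =A [::].
Proof. by rewrite -{2}[w]winvK; apply: cat_winv. Qed.

Lemma catwK a w : a ++ w ++ winv w =A a.
Proof. by rewrite cat_winv cats0; reflexivity. Qed.

Lemma altS_last (u v : V) n :
  alt u v n.+1 = alt u v n ++ [:: (if odd n then v else u, true)].
Proof.
elim: n u v => [//|n IH] u v.
rewrite -[LHS]/((u, true) :: alt v u n.+1) IH /=.
by case: (odd n).
Qed.

Lemma mem_alt (u v : V) n x : x \in alt u v n -> x = (u, true) \/ x = (v, true).
Proof.
elim: n u v => //= n IH u v; rewrite inE => /orP[/eqP->|/IH]; first by left.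
by case; [right|left].
Qed.

(** Moving a letter across the word [alt u v m] fixes it if [m] is even and exchanges [u] and [v] if
    [m] is odd, so the square of that word commutes with both. *)
Lemma alt_sq_comm (u v : V) : symmetric adj -> adj u v -> lab u v = lab v u ->
  let z := alt u v (lab u v) ++ alt u v (lab u v) in
  [:: (u, true)] ++ z =A z ++ [:: (u, true)] /\
  [:: (v, true)] ++ z =A z ++ [:: (v, true)].
Proof.
move=> sadj uv labE z; set m := lab u v in z *.
have DE : alt u v m =A alt v u m.
  by have := ae_rel lab [::] [::] uv; rewrite /= !cats0 -/m.
have uD x y : x = u /\ y = v \/ x = v /\ y = u ->
    [:: (x, true)] ++ alt u v m =A alt u v m ++ [:: (if odd m then y else x, true)].
  move=> xy; have D1 : alt u v m =A alt x y m.
    by case: xy => [[-> ->]|[-> ->]]; [reflexivity|].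
  have D2 : alt u v m =A alt y x m.
    by case: xy => [[-> ->]|[-> ->]]; [|reflexivity].
  rewrite {1}D2 D1 -altS_last; reflexivity.
have swap x y : x = u /\ y = v \/ x = v /\ y = u ->
    [:: (x, true)] ++ z =A z ++ [:: (x, true)].
  move=> xy; rewrite /z catA (uD x y xy) -catA.
  have xy' : (if odd m then y else x) = u /\ (if odd m then x else y) = v \/
      (if odd m then y else x) = v /\ (if odd m then x else y) = u.
    by case: (odd m) => //; case: xy => [[-> ->]|[-> ->]]; [right|left].
  rewrite (uD _ _ xy'); case: (odd m); rewrite catA; reflexivity.
by split; [apply: (swap u v); left|apply: (swap v u); right].
Qed.

Lemma comm_winv a z : a ++ z =A z ++ a -> winv a ++ z =A z ++ winv a.
Proof.
move=> az; transitivity (winv a ++ (a ++ z) ++ winv a).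
  by rewrite az -catA cat_winv cats0; reflexivity.
by rewrite !catA winv_cat; reflexivity.
Qed.

End ArtinCongruence.

#[local] Existing Instance artin_eq_equiv.
#[local] Existing Instance artin_eq_cat.

(** * Heights of words and of paths in the Cayley graph *)

Section Character.
Variables (V : finType) (adj : rel V) (lab : V -> V -> nat) (R : realType).
Variables (chi : word V -> R) (Hchi : is_character adj lab chi).
Local Notation word := (word V).
Local Notation "a =A b" := (artin_eq adj lab a b) (at level 70).

Lemma chi_eq a b : a =A b -> chi a = chi b.
Proof. exact: Hchi.1. Qed.

Lemma chi_cat a b : chi (a ++ b) = chi a + chi b.
Proof. exact: Hchi.2. Qed.

Lemma chi_nil : chi [::] = 0.
Proof. by have := chi_cat [::] [::] => /= H; lra. Qed.

Lemma chi_cons x w : chi (x :: w) = chi [:: x] + chi w.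
Proof. by rewrite -cat1s chi_cat. Qed.

Lemma chi_letterN v s : chi [:: (v, ~~ s)] = - chi [:: (v, s)].
Proof.
have := chi_eq (ae_free adj lab [::] [::] v s).
by rewrite /= chi_cons chi_nil => ?; lra.
Qed.

Lemma chi_winv w : chi (winv w) = - chi w.
Proof. by have := chi_eq (cat_winv adj lab w); rewrite chi_cat chi_nil => ?; lra. Qed.

Lemma chi_letterE v s : chi [:: (v, s)] = if s then chiv chi v else - chiv chi v.
Proof. by case: s => //; rewrite (chi_letterN v true). Qed.

Lemma living_letter v : living chi v -> exists s, 0 < chi [:: (v, s)].
Proof.
rewrite /living neq_lt => /orP[lt0|gt0]; last by exists true.
by exists false; rewrite chi_letterE oppr_gt0.
Qed.

Lemma letter_living v s : 0 < chi [:: (v, s)] -> living chi v.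
Proof.
rewrite /living => v0; apply: contraTneq v0; rewrite chi_letterE => ->.
by rewrite oppr0 if_same ltxx.
Qed.

Lemma exists_living : (exists w, chi w != 0) -> exists v, living chi v.
Proof.
case=> w; apply: contraNP => dead; apply/eqP.
elim: w => [|[v s] w IH]; first exact: chi_nil.
rewrite chi_cons IH chi_letterE.
have -> : chiv chi v = 0.
  by apply/eqP; apply: contra_notT dead => nz; exists v.
by case: s; lra.
Qed.

Lemma chi_alt u v n :
  chi (alt u v n) = chiv chi u *+ uphalf n + chiv chi v *+ n./2.
Proof.
elim: n u v => [|n IH] u v; first by rewrite chi_nil !mulr0n addr0.
rewrite [alt _ _ _]/= chi_cons IH -/(chiv chi u).
by rewrite /= mulrS [_ *+ uphalf n + _]addrC addrA.
Qed.

Lemma chiv_odd u v : adj u v -> odd (lab u v) -> chiv chi u = chiv chi v.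
Proof.
move=> uv om; have := chi_eq (ae_rel lab [::] [::] uv).
rewrite /= !cats0 !chi_alt uphalf_half om add1n !mulrS => ?; lra.
Qed.

(** For an odd label both ends have the same value and the height is the label times it; for an even
    one it is half the label times the sum of the two values. *)
Lemma chi_alt_lab_neq0 u v : adj u v -> (2 < lab u v)%N -> living chi u ->
  ~~ dead_edge adj lab chi u v -> chi (alt u v (lab u v)) != 0.
Proof.
move=> uv m2 livu; rewrite /dead_edge uv m2 /= chi_alt uphalf_half.
case om: (odd _) => /= nd.
  rewrite -(chiv_odd uv om) -mulrnDr mulrn_eq0 negb_or; apply/andP; split=> //.
rewrite add0n -mulrnDl mulrn_eq0 negb_or nd andbT.
by case: (lab u v) m2 => [|[|]].
Qed.

(** A word is read as a path in the Cayley graph, of whose starting point only the height [h]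
    matters. *)
Fixpoint abv (l h : R) (w : word) : bool :=
  (l <= h) && (if w is x :: w' then abv l (h + chi [:: x]) w' else true).

Lemma abv_start l h w : abv l h w -> l <= h.
Proof. by case: w => [|x w] /=; case/andP. Qed.

Lemma abv_cat l h w1 w2 : abv l h (w1 ++ w2) = abv l h w1 && abv l (h + chi w1) w2.
Proof.
elim: w1 h => [|x w1 IH] h /=.
  by rewrite chi_nil addr0 andbT; case lh: (l <= h) => //; case: w2 => [|? ?] /=; rewrite lh.
by rewrite IH andbA (chi_cons x w1) addrA.
Qed.

Lemma abv_end l h w : abv l h w -> l <= h + chi w.
Proof. by rewrite -{1}[w]cats0 abv_cat => /andP[_ /abv_start]. Qed.

Lemma abv_winv l h w : abv l (h + chi w) (winv w) = abv l h w.
Proof.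
elim: w h => [|[v s] w IH] h; first by rewrite /= chi_nil addr0.
rewrite winv_cons abv_cat [abv l h _]/= chi_cons addrA IH chi_winv addrK /= andbT.
rewrite chi_letterN addrK; case H: (abv _ _ w); rewrite /= ?andbF ?andbT //.
by rewrite (abv_start H).
Qed.

Lemma abv_shift k l h w : abv (l + k) (h + k) w = abv l h w.
Proof. by elim: w h => [|x w IH] h /=; rewrite lerD2r // addrAC IH. Qed.

Lemma abv_le l l' h w : l' <= l -> abv l h w -> abv l' h w.
Proof.
by move=> ll; elim: w h => [|x w IH] h /= /andP[lh H]; rewrite (le_trans ll lh) ?IH.
Qed.

Lemma abv_bound h w : exists l, abv l h w.
Proof.
elim: w h => [|x w IH] h; first by exists h; rewrite /= lexx.
have [l lw] := IH (h + chi [:: x]).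
exists (Order.min l h); rewrite /= ge_min lexx orbT /=.
by apply: abv_le lw; rewrite ge_min lexx.
Qed.

(** The heights have a positive lower bound [l], which becomes the gain [e] in [push_letter]. *)
Definition reach a b := exists q l,
  [/\ 0 < l, a ++ q =A b & abv l (chi a) q].

Lemma reach_refl a b : 0 < chi a -> a =A b -> reach a b.
Proof. by move=> a0 ab; exists [::], (chi a); rewrite cats0 /= lexx. Qed.

Lemma reach_trans b a c : reach a b -> reach b c -> reach a c.
Proof.
move=> [q [l [l0 ab lq]]] [q' [l' [l'0 bc lq']]].
exists (q ++ q'), (Order.min l l'); split; first by rewrite lt_min l0.
  by rewrite catA ab.
rewrite abv_cat -chi_cat (chi_eq ab) (abv_le _ lq) ?ge_min ?lexx //=.
by rewrite (abv_le _ lq') // ge_min lexx orbT.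
Qed.

Lemma reach_sym a b : reach a b -> reach b a.
Proof.
move=> [q [l [l0 ab lq]]]; exists (winv q), l; split=> //.
  by rewrite -ab -catA; apply: catwK.
by rewrite -(chi_eq ab) chi_cat abv_winv.
Qed.

(** The path runs from [x] up to [x^(N+1)], then along [z], then from [x^(N+1) z = z x^(N+1)] back
    down to [z]. *)
Lemma reach_comm x z : [:: x] ++ z =A z ++ [:: x] ->
  0 < chi [:: x] -> 0 < chi z -> reach [:: x] z.
Proof.
move=> xz x0 z0; pose e := Order.min (chi [:: x]) (chi z).
have e0 : 0 < e by rewrite lt_min x0.
have abv_nseq h n : e <= h -> abv e h (nseq n x).
  elim: n h => [|n IH] h eh /=; first by rewrite eh.
  by rewrite eh IH // (le_trans eh) // lerDl ltW.
have zxn n : z ++ nseq n x =A nseq n x ++ z.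
  elim: n => [|n IH]; first by rewrite cats0; reflexivity.
  rewrite -[nseq n.+1 x]/([:: x] ++ nseq n x) catA -xz -catA IH catA; reflexivity.
have chi_nseq n : chi (nseq n x) = chi [:: x] *+ n.
  elim: n => [|n IH]; first by rewrite mulr0n chi_nil.
    by rewrite mulrS -IH -chi_cons.
have [l lz] := abv_bound 0 z.
(* [N] makes up for the lowest height [l] of the word [z] read from height 0. *)
have [N lN] : exists N, e - l <= chi [:: x] *+ N.
  have [N HN] : exists N : nat, (e - l) / chi [:: x] < N%:R.
    by exists (Num.truncn `|(e - l) / chi [:: x]|).+1; rewrite (le_lt_trans (ler_norm _)) // truncnS_gt.
  by exists N; rewrite -mulr_natl -ler_pdivrMr // ltW.
have up : reach [:: x] (nseq N.+1 x).
  exists (nseq N x), e; split=> //; first exact: ae_refl.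
  by apply: abv_nseq; rewrite ge_min lexx.
apply: (reach_trans up); apply: (@reach_trans (nseq N.+1 x ++ z)).
  exists z, e; split=> //; first exact: ae_refl.
  have := lz; rewrite -(abv_shift (chi [:: x] *+ N.+1)) add0r chi_nseq.
  by apply: abv_le; rewrite mulrS; lra.
apply: reach_sym; exists (nseq N.+1 x), e; split; [by []|exact: (zxn N.+1)|].
by apply: abv_nseq; rewrite ge_min lexx orbT.
Qed.

Lemma comm_letter x z : [:: (x, true)] ++ z =A z ++ [:: (x, true)] ->
  forall s, [:: (x, s)] ++ z =A z ++ [:: (x, s)].
Proof. by move=> xz [//|]; apply: (comm_winv xz). Qed.

Lemma comm_letter2 x y : [:: (x, true)] ++ [:: (y, true)] =A [:: (y, true)] ++ [:: (x, true)] ->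
  forall s s', [:: (x, s)] ++ [:: (y, s')] =A [:: (y, s')] ++ [:: (x, s)].
Proof.
move=> xy s s'; symmetry; apply: comm_letter; symmetry.
exact: comm_letter.
Qed.

Lemma comm_positive z : chi z != 0 -> exists2 z', 0 < chi z' &
  forall x, [:: (x, true)] ++ z =A z ++ [:: (x, true)] ->
  forall s, [:: (x, s)] ++ z' =A z' ++ [:: (x, s)].
Proof.
rewrite neq_lt => /orP[z0|z0]; last by exists z => // x xz s; apply: comm_letter.
exists (winv z) => [|x xz s]; first by rewrite chi_winv oppr_gt0.
by symmetry; apply: comm_winv; symmetry; apply: comm_letter.
Qed.

(** * Reachability along the living subgraph *)

Hypotheses (adj_sym : symmetric adj)
  (lab_sym : forall u v, adj u v -> lab u v = lab v u)
  (lab_ge2 : forall u v, adj u v -> (2 <= lab u v)%N).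

(* For labels above 2 the positive power of the central element [alt u v m ++ alt u v m] serves as [z]. *)
Lemma edge_comm u v s : adj u v -> ~~ dead_edge adj lab chi u v ->
  0 < chi [:: (u, s)] -> exists z,
    [/\ 0 < chi z, reach [:: (u, s)] z, forall s', [:: (v, s')] ++ z =A z ++ [:: (v, s')] &
      forall s', 0 < chi [:: (v, s')] -> reach [:: (v, s')] z].
Proof.
move=> uv nd us0; have := lab_ge2 uv; rewrite leq_eqVlt => /orP[/eqP m2|m2].
  have vu s1 s2 : [:: (v, s1)] ++ [:: (u, s2)] =A [:: (u, s2)] ++ [:: (v, s1)].
    apply: comm_letter2; symmetry.
    by have := ae_rel lab [::] [::] uv; rewrite -m2.
  exists [:: (u, s)]; split=> // [|s' vs0]; first by apply: reach_refl => //; reflexivity.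
  exact: reach_comm.
have livu := letter_living us0.
have [uz vz] := alt_sq_comm adj_sym uv (lab_sym uv).
have : chi (alt u v (lab u v) ++ alt u v (lab u v)) != 0.
  by rewrite chi_cat -mulr2n mulrn_eq0 chi_alt_lab_neq0.
move=> /comm_positive[z z0 zP].
exists z; split=> // [|s'|s' vs0]; [|exact: zP|].
  by apply: reach_comm => //; apply: zP.
by apply: reach_comm => //; apply: zP.
Qed.

Lemma liv_rel_reach u v s s' : liv_rel adj lab chi u v ->
  0 < chi [:: (u, s)] -> 0 < chi [:: (v, s')] -> reach [:: (u, s)] [:: (v, s')].
Proof.
case/and4P=> _ _ uv nd us0 vs0; have [z [_ uz _ vz]] := edge_comm uv nd us0.
by apply: (reach_trans uz); apply: reach_sym; apply: vz.
Qed.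

Lemma connect_reach u v s s' : connect (liv_rel adj lab chi) u v ->
  0 < chi [:: (u, s)] -> 0 < chi [:: (v, s')] -> reach [:: (u, s)] [:: (v, s')].
Proof.
case/connectP=> p; elim: p u s => [|w p IH] u s /=.
  move=> _ -> us0 vs0; apply: reach_refl => //.
  suff -> : s = s' by reflexivity.
  by move: us0 vs0; rewrite !chi_letterE; case: s s' => [] [] //; lra.
case/andP=> uw wp vE us0 vs0; have /and4P[_ livw _ _] := uw.
have [sw ws0] := living_letter livw.
by apply: (reach_trans (liv_rel_reach uw us0 ws0)); apply: IH.
Qed.

Lemma reach_centralizer t st v :
  Liv_connected adj lab chi -> Liv_dominant adj chi -> 0 < chi [:: (t, st)] ->
  exists2 z, reach [:: (t, st)] z & forall s, [:: (v, s)] ++ z =A z ++ [:: (v, s)].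
Proof.
move=> conn dom t0.
have livt := letter_living t0.
have [livv|deadv] := boolP (living chi v).
  have [s v0] := living_letter livv; exists [:: (v, s)].
    by apply: connect_reach => //; apply: conn.
  move=> s'; apply: comm_letter2; reflexivity.
have [u /andP[livu vu]] := dom v deadv; have [s u0] := living_letter livu.
have uv : adj u v by rewrite adj_sym.
(* The values at the two ends add up to [chiv chi u], which is not 0. *)
have nd : ~~ dead_edge adj lab chi u v.
  move: deadv; rewrite /living negbK => /eqP v0.
  by rewrite /dead_edge v0 addr0 -[_ == 0]negbK -/(living _ _) livu !andbF.
have [z [_ uz vz _]] := edge_comm uv nd u0.
by exists z => //; apply: reach_trans uz; apply: connect_reach => //; apply: conn.
Qed.

Lemma eps_uniform (T : eqType) (P : T -> R -> Prop) (s : seq T) :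
  (forall x e e', e' <= e -> P x e -> P x e') -> (forall x, exists2 e, 0 < e & P x e) ->
  exists2 e, 0 < e & forall x, x \in s -> P x e.
Proof.
move=> Ple Pex; elim: s => [|x s [e e0 IH]]; first by exists 1.
have [e' e'0 Px] := Pex x; exists (Order.min e e'); first by rewrite lt_min e0.
move=> y; rewrite inE => /orP[/eqP->|/IH].
  by apply: Ple Px; rewrite ge_min lexx orbT.
by apply: Ple; rewrite ge_min lexx.
Qed.

(** * Pushing paths upwards *)

Section Push.
Hypotheses (conn : Liv_connected adj lab chi) (dom : Liv_dominant adj chi).
Variables (t : V * bool) (t0 : 0 < chi [:: t]).

(** Follow [q] from [t] to an element [z] commuting with [x], apply [x], and return along the
    translate of [q] by [x]; the margin [e] is the lower bound of heights on [q]. *)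
Lemma push_letter x : exists2 e, 0 < e & exists p,
  [:: t] ++ p =A [:: x] ++ [:: t] /\ abv (Order.min 0 (chi [:: x]) + e) (chi [:: t]) p.
Proof.
case: t t0 => tv ts tp; case: x => v s; set x := (v, s).
have [z [q [l [l0 tq lq]]] zv] := reach_centralizer v conn dom tp.
exists l => //; exists (q ++ [:: x] ++ winv q); split.
  rewrite catA tq catA -zv -tq -!catA cat_winv cats0; reflexivity.
rewrite abv_cat (abv_le _ lq); last by rewrite gerDr ge_min lexx.
rewrite -chi_cat (chi_eq tq) cat1s [abv _ _ (_ :: _)]/=.
have zl : l <= chi z by have := abv_end lq; rewrite -chi_cat (chi_eq tq).
have chiz : chi z = chi [:: (tv, ts)] + chi q by rewrite -(chi_eq tq) chi_cat.
apply/andP; split=> //; rewrite chiz addrAC abv_winv -chiz.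
apply/andP; split; first by apply: le_trans zl; rewrite gerDr ge_min lexx.
have := lq; rewrite -(abv_shift (chi [:: x])); apply: abv_le.
by rewrite addrC lerD2l ge_min lexx orbT.
Qed.

(** The new path visits [g t] for each prefix [g] of [w], joined by translates of the paths of
    [push_letter]; both ends of each letter of [w] have height at least [l]. *)
Lemma push_word : exists2 e, 0 < e & forall w l h, abv l h w ->
  exists w', [:: t] ++ w' =A w ++ [:: t] /\ abv (l + e) (h + chi [:: t]) w'.
Proof.
have shrink x e e' : e' <= e -> (exists p, [:: t] ++ p =A [:: x] ++ [:: t] /\
      abv (Order.min 0 (chi [:: x]) + e) (chi [:: t]) p) ->
    exists p, [:: t] ++ p =A [:: x] ++ [:: t] /\
      abv (Order.min 0 (chi [:: x]) + e') (chi [:: t]) p.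
  by move=> ee' [p [pE lp]]; exists p; split=> //; apply: abv_le lp; rewrite lerD2l.
have [e e0 eP] := eps_uniform (enum {: V * bool}) shrink push_letter.
(* [chi [:: t]] limits the gain for the empty word, whose path is a single vertex. *)
exists (Order.min e (chi [:: t])); first by rewrite lt_min e0.
elim=> [|x w IH] l h.
  rewrite /= andbT => lh; exists [::]; split; first by reflexivity.
  by rewrite /= andbT lerD // ge_min lexx orbT.
move=> lxw; have /= /andP[lh lw] := lxw; have [w' [w'E lw']] := IH _ _ lw.
have [p [pE lp]] := eP x (mem_enum _ _).
exists (p ++ w'); split.
  by rewrite -cat1s catA pE -catA w'E; apply: ae_refl.
have chip : chi p = chi [:: x].
  by have := chi_eq pE; rewrite !chi_cat; lra.
rewrite abv_cat chip addrAC lw' andbT.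
have := lp; rewrite -(abv_shift h) [X in abv _ X _]addrC; apply: abv_le.
have lx := abv_start lw.
apply: (@le_trans _ _ (l + e)); first by rewrite lerD2l ge_min lexx.
rewrite addrAC lerD2r -lerBlDr le_min; lra.
Qed.

Lemma path_nonneg w : 0 <= chi w -> exists2 w', w =A w' & abv 0 0 w'.
Proof.
move=> w0; have [e e0 push] := push_word.
have [l lw] := abv_bound 0 w.
(* Each round replaces the path by [t w2 t^-1], with the same ends at heights 0 and [chi w]; so the
   bound gains [e] but is capped at 0. *)
have H n : exists2 w', w =A w' & abv (Order.min 0 (l + e *+ n)) 0 w'.
  elim: n => [|n [w' ww' lw']].
    by exists w; [reflexivity|rewrite addr0; apply: abv_le lw; rewrite ge_min lexx orbT].
  have [w2 [w2E lw2]] := push _ _ _ lw'.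
  exists ([:: t] ++ w2 ++ winv [:: t]).
    by rewrite ww' catA w2E -catA cat_winv cats0; reflexivity.
  have chi2 : chi w2 = chi w.
    by have := chi_eq w2E; rewrite !chi_cat (chi_eq ww'); lra.
  set m := Order.min 0 (l + e *+ n.+1).
  have m0 : m <= 0 by rewrite ge_min lexx.
  rewrite abv_cat [abv _ _ [:: t]]/= m0 add0r (le_trans m0 (ltW t0)) abv_cat /=.
  apply/andP; split; last first.
    rewrite [X in X && _](_ : _ = true) /=; last by rewrite chi2 (le_trans m0) // addr_ge0 // ltW.
    rewrite andbT chi2 (le_trans m0) //.
    have -> : chi [:: (t.1, ~~ t.2)] = - chi [:: t] by case: (t) => a b; rewrite chi_letterN.
    by rewrite addrAC subrr add0r.
  have := lw2; rewrite add0r; apply: abv_le.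
  rewrite /m mulrSr addrA minElt [Order.min 0 (l + _)]minElt.
  by case: ltP => ?; case: ltP => ?; lra.
have [n Hn] : exists n : nat, - l / e < n%:R.
  by exists (Num.truncn `|- l / e|).+1; rewrite (le_lt_trans (ler_norm _)) // truncnS_gt.
have [w' ww' lw'] := H n; exists w' => //; apply: abv_le lw'.
rewrite le_min lexx -lerBlDl sub0r -mulr_natl -ler_pdivrMr //.
exact: ltW.
Qed.

End Push.

End Character.

(** * Linear extension of functions on words to the group ring *)

Section FormalSums.
Variables (V : finType) (adj : rel V) (lab : V -> V -> nat).
Local Notation word := (word V).
Local Notation fsum := (fsum V).
Local Notation "a =A b" := (artin_eq adj lab a b) (at level 70).
Local Notation eqR := (eqR adj lab).
Local Notation coef := (coef adj lab).

Definition lin (W : zmodType) (phi : word -> W) (c : fsum) : W :=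
  \sum_(p <- c) phi p.2 *~ p.1.

Definition negF (c : fsum) : fsum := [seq (- p.1, p.2) | p <- c].

Section Lin.
Variables (W : zmodType) (phi : word -> W).

Lemma lin_cat c1 c2 : lin phi (c1 ++ c2) = lin phi c1 + lin phi c2.
Proof. exact: big_cat. Qed.

Lemma lin_nil : lin phi [::] = 0.
Proof. exact: big_nil. Qed.

Lemma lin_neg c : lin phi (negF c) = - lin phi c.
Proof. by rewrite /lin big_map -sumrN; apply: eq_bigr => p _; rewrite mulrNz. Qed.

Lemma lin_bigcat n (F : 'I_n -> fsum) :
  lin phi (\big[cat/[::]]_(j < n) F j) = \sum_(j < n) lin phi (F j).
Proof. exact: (big_morph _ lin_cat lin_nil). Qed.

Lemma lin_mulF c1 c2 : lin phi (mulF c1 c2) =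
  \sum_(p <- c1) (\sum_(q <- c2) phi (p.2 ++ q.2) *~ q.1) *~ p.1.
Proof.
rewrite /lin /mulF big_allpairs_dep /=; apply: eq_bigr => p _.
by rewrite mulrz_suml; apply: eq_bigr => q _; rewrite mulrzAC mulrzA.
Qed.

End Lin.

Lemma aug_lin (c : fsum) : aug c = lin (fun=> 1) c.
Proof. by apply: eq_bigr => p _; rewrite intz. Qed.

Definition indA (g a : word) : int := if `[< a =A g >] then 1 else 0.

Lemma coef_lin c g : coef c g = lin (indA g) c.
Proof.
by apply: eq_bigr => p _; rewrite /indA; case: ifP => _; rewrite ?intz ?mul0rz.
Qed.

Lemma indA_eq g a b : a =A b -> indA g a = indA g b.
Proof.
move=> ab; rewrite /indA; congr (if _ then _ else _).
by apply: asbool_equiv_eq; split; apply: ae_trans => //; apply: ae_sym.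
Qed.

(** Induction on the length: the words equal in the group to the head [a] contribute [phi a] times
    the coefficient of [a], that is 0, and deleting them leaves all coefficients 0. *)
Lemma lin_eq0 (W : zmodType) (phi : word -> W) :
  (forall a b, a =A b -> phi a = phi b) ->
  forall c, (forall g, coef c g = 0) -> lin phi c = 0.
Proof.
move=> phiE c; have [n] := ubnP (size c); elim: n c => // n IH [|[k a] c] szc c0.
  exact: lin_nil.
pose P (p : int * word) := `[< p.2 =A a >].
rewrite /lin (bigID P) /=.
have -> : \sum_(p <- (k, a) :: c | P p) phi p.2 *~ p.1 = phi a *~ coef ((k, a) :: c) a.
  rewrite /coef -big_mkcond /= mulrz_sumr; apply: eq_bigr => p /asboolP pa.
  by rewrite (phiE _ _ pa).
rewrite c0 mulr0z add0r -big_filter; apply: IH => [|g].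
  rewrite size_filter /= [P _](_ : _ = true) ?add0n.
    by apply: leq_ltn_trans (count_size _ _) _.
  by apply/asboolP/ae_refl.
have [ga|ga] := pselect (a =A g).
  rewrite /coef big_filter big1 // => p.
  rewrite /P; case: asboolP => //= pa; case: asboolP => // pg; case: pa.
  by rewrite pg ga; apply: ae_refl.
rewrite -(c0 g) /coef [RHS](bigID P) big_filter [X in _ = X + _]big1 ?add0r //.
move=> p /= /asboolP pa; case: asboolP => // pg; case: ga.
by rewrite -pg pa; apply: ae_refl.
Qed.

Lemma lin_eqR (W : zmodType) (phi : word -> W) :
  (forall a b, a =A b -> phi a = phi b) ->
  forall c1 c2, eqR c1 c2 -> lin phi c1 = lin phi c2.
Proof.
move=> phiE c1 c2 cE; apply/eqP; rewrite -subr_eq0 -lin_neg -lin_cat; apply/eqP.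
apply: lin_eq0 => // g; rewrite coef_lin lin_cat lin_neg -!coef_lin cE; exact: subrr.
Qed.

Lemma aug_eqR (c1 c2 : fsum) : eqR c1 c2 -> aug c1 = aug c2.
Proof. by rewrite !aug_lin; apply: lin_eqR. Qed.

Lemma aug_mulF (c1 c2 : fsum) : aug (mulF c1 c2) = aug c1 * aug c2.
Proof.
rewrite !aug_lin lin_mulF [lin _ c1]/lin mulr_suml.
by apply: eq_bigr => p _; rewrite mulrzl.
Qed.

End FormalSums.

(** * Presenting the trivial module from paths of nonnegative height *)

Section Sigma1Suffices.
Variables (V : finType) (adj : rel V) (lab : V -> V -> nat) (R : realType).
Variables (chi : word V -> R) (Hchi : is_character adj lab chi).
Local Notation word := (word V).
Local Notation fsum := (fsum V).
Local Notation "a =A b" := (artin_eq adj lab a b) (at level 70).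
Local Notation coef := (coef adj lab).
Local Notation indA := (indA adj lab).

Let m := #|{: V * bool}|.

(** A letter of negative height gives 0, because [x - 1] would lie outside the ring over [G_chi];
    its inverse letter takes its place. *)
Definition letter_sub1 (x : V * bool) : fsum :=
  if 0 <= chi [:: x] then [:: (1, [:: x]); (-1, [::])] else [::].

Let M (j : 'I_m) (i : 'I_1) : fsum := letter_sub1 (enum_val j).

Lemma inG_letter_sub1 x : inG chi (letter_sub1 x).
Proof. by rewrite /letter_sub1; case: ifP => //= ->; rewrite (chi_nil Hchi) lexx. Qed.

Lemma aug_letter_sub1 x : aug (letter_sub1 x) = 0.
Proof.
by rewrite /letter_sub1 /aug; case: ifP => _; rewrite ?big_cons big_nil.
Qed.

(** Membership in the left ideal generated by the [letter_sub1], phrased for coefficient functions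
    so that sums are pointwise. *)
Definition realized (f : word -> int) := exists y : 'I_m -> fsum,
  (forall j, inG chi (y j)) /\
  forall g, f g = \sum_(j < m) coef (mulF (y j) (letter_sub1 (enum_val j))) g.

Lemma realizedD f1 f2 : realized f1 -> realized f2 -> realized (fun g => f1 g + f2 g).
Proof.
move=> [y1 [in1 E1]] [y2 [in2 E2]]; exists (fun j => y1 j ++ y2 j); split=> [j|g].
  by rewrite /inG all_cat [all _ _]in1 [all _ _]in2.
rewrite E1 E2 -big_split; apply: eq_bigr => j _ /=.
by rewrite /mulF allpairs_cat !coef_lin lin_cat.
Qed.

Lemma realized0 f : (forall g, f g = 0) -> realized f.
Proof.
move=> f0; exists (fun=> [::]); split=> // g.
by rewrite f0 big1 // => j _; rewrite coef_lin lin_nil.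
Qed.

Lemma realized_sum (I : Type) (r : seq I) (P : I -> bool) (f : I -> word -> int) :
  (forall i, P i -> realized (f i)) -> all P r ->
  realized (fun g => \sum_(i <- r) f i g).
Proof.
move=> fr; elim: r => [_|i r IH /= /andP[Pi Pr]].
  by apply: realized0 => g; rewrite big_nil.
have [y [iny yE]] := realizedD (fr i Pi) (IH Pr).
by exists y; split=> // g; rewrite big_cons yE.
Qed.

Lemma realized_letter k w x : 0 <= chi w -> 0 <= chi [:: x] ->
  realized (fun g => k * (indA g (w ++ [:: x]) - indA g w)).
Proof.
move=> w0 x0; exists (fun j => if j == enum_rank x then [:: (k, w)] else [::]); split.
  by move=> j; case: ifP => //= _; rewrite w0.
move=> g; rewrite (bigD1 (enum_rank x)) //= eqxx big1 ?addr0 => [|j /negPf->].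
  rewrite enum_rankK /letter_sub1 x0 coef_lin lin_mulF !big_cons !big_nil /=.
  by rewrite cats0 !addr0 mulr1z mulrN1z -mulrzl intz.
by rewrite coef_lin lin_nil.
Qed.

Lemma realized_path k w0 w : abv chi 0 (chi w0) w ->
  realized (fun g => k * (indA g (w0 ++ w) - indA g w0)).
Proof.
elim: w w0 => [|x w IH] w0; first by move=> _; apply: realized0 => g; rewrite cats0 subrr mulr0.
move=> /= /andP[w00 ]; rewrite -(chi_cat Hchi) => lw.
have [y [iny yE]] : realized (fun g => k * (indA g (w0 ++ [:: x]) - indA g w0)).
  have [x0|x0] := leP 0 (chi [:: x]); first exact: realized_letter.
  (* A step down from [w0] to [w0 x] is minus the step up from [w0 x] along the inverse letter. *)
  have [| |y [iny yE]] := @realized_letter (- k) (w0 ++ [:: x]) (x.1, ~~ x.2).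
  - exact: abv_start lw.
  - by case: (x) x0 => v s; rewrite (chi_letterN Hchi) oppr_ge0 => /ltW.
  exists y; split=> // g; rewrite -yE.
  rewrite (@indA_eq _ _ _ _ ((w0 ++ [:: x]) ++ _) w0); first by ring.
  rewrite -catA; case: (x) => v s /=.
  by have := ae_free adj lab w0 [::] v s; rewrite cats0.
have [y' [iny' yE']] := realizedD (IH _ lw) (ex_intro _ y (conj iny yE)).
exists y'; split=> // g; rewrite -yE' -catA /=; ring.
Qed.

(** A sum of augmentation 0 is unchanged when each [g] in it is replaced by [g - 1], and [g - 1]
    telescopes along a path from 1 to [g]. *)
Lemma FP1_of_paths :
  (forall w, 0 <= chi w -> exists2 w', w =A w' & abv chi 0 0 w') ->
  FP1_trivial adj lab chi.
Proof.
move=> paths; exists 1%N, (fun=> 1), m, M; split.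
  by move=> j i; apply: inG_letter_sub1.
split=> [k|x inx].
  exists (fun=> [:: (k, [::])]); split; first by move=> i; rewrite /= (chi_nil Hchi) lexx.
  by rewrite big_ord1 /aug big_seq1 mulr1.
rewrite big_ord1 mulr1; split=> [aug0|[y [iny yE]]]; last first.
  rewrite (aug_eqR (yE ord0)) aug_lin lin_bigcat big1 // => j _.
  by rewrite -aug_lin aug_mulF aug_letter_sub1 mulr0.
have [y [iny yE]] : realized (fun g => \sum_(p <- x ord0) p.1 * (indA g p.2 - indA g [::])).
  apply: (@realized_sum _ _ (fun p => 0 <= chi p.2) (fun p g => p.1 * (indA g p.2 - indA g [::]))) (inx ord0).
  move=> p /paths[w' ww' lw']; have [|y [iny yE]] := @realized_path p.1 [::] w'.
    by rewrite (chi_nil Hchi).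
  by exists y; split=> // g; rewrite -yE (indA_eq _ ww').
exists y; split=> // i; rewrite ord1 => g.
rewrite !coef_lin lin_bigcat; under eq_bigr do rewrite -coef_lin.
rewrite -yE; under eq_bigr do rewrite mulrBr.
rewrite sumrB -mulr_suml -/(aug _) aug0 mul0r subr0.
by apply: eq_bigr => p _; rewrite -mulrzl intz.
Qed.

Lemma Sigma1_of_Liv (adj_sym : symmetric adj)
  (lab_sym : forall u v, adj u v -> lab u v = lab v u)
  (lab_ge2 : forall u v, adj u v -> (2 <= lab u v)%N) :
  (exists w, chi w != 0) ->
  Liv_connected adj lab chi -> Liv_dominant adj chi -> in_Sigma1 adj lab chi.
Proof.
move=> /(exists_living Hchi)[v /(living_letter Hchi)[s vs0]] conn dom.
by apply: FP1_of_paths => w; apply: path_nonneg vs0 _.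
Qed.

End Sigma1Suffices.

(** * Cocycles with values in functions of the height, and bounds on their supports *)

Section Cocycle.
Variables (V : finType) (adj : rel V) (lab : V -> V -> nat) (R : realType).
Variables (chi : word V -> R) (Hchi : is_character adj lab chi).
Local Notation word := (word V).
Local Notation fsum := (fsum V).
Local Notation "a =A b" := (artin_eq adj lab a b) (at level 70).
Variables (W : zmodType) (rho : V -> {additive W -> W}) (c : V -> R -> W).

(** The exponent of a letter is ignored, because the [rho v] will be involutions. *)
Fixpoint rhow (w : word) (x : W) : W := if w is l :: w' then rho l.1 (rhow w' x) else x.

(* The functions [R -> W] carry the action twisting [rho] by translation along [chi]; the generator [v] acts by
   this linear action conjugated by the translation by [c v], and the orbit of 0 is a 1-cocycle. *)
Fixpoint affw (w : word) (f : R -> W) : R -> W :=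
  if w is l :: w' then fun r =>
    rho l.1 (affw w' f (r - chi [:: l]) + c l.1 (r - chi [:: l])) - c l.1 r
  else f.

Definition cocycle (w : word) : R -> W := affw w (fun=> 0).

Lemma rhow0 w : rhow w 0 = 0.
Proof. by elim: w => //= l w ->; rewrite raddf0. Qed.

Lemma rhow_sumMz w (I : Type) (r : seq I) (F : I -> W) (k : I -> int) :
  rhow w (\sum_(i <- r) F i *~ k i) = \sum_(i <- r) rhow w (F i) *~ k i.
Proof.
elim: w => //= l w ->; rewrite raddf_sum; apply: eq_bigr => i _.
by rewrite raddfMz.
Qed.

Lemma affw_cat w1 w2 f : affw (w1 ++ w2) f = affw w1 (affw w2 f).
Proof. by elim: w1 => //= l w1 ->. Qed.

Lemma affwE w f r : affw w f r = rhow w (f (r - chi w)) + cocycle w r.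
Proof.
elim: w f r => [|l w IH] f r; first by rewrite /= (chi_nil Hchi) subr0 addr0.
rewrite /cocycle /= !IH rhow0 add0r !raddfD -!addrA.
by rewrite (chi_cons Hchi l w) opprD.
Qed.

Lemma cocycle_cat w1 w2 r :
  cocycle (w1 ++ w2) r = rhow w1 (cocycle w2 (r - chi w1)) + cocycle w1 r.
Proof. by rewrite /cocycle affw_cat affwE. Qed.

(** Conjugations by one common translation telescope along the word. Where a single [c0] serves both
    ends of an edge, the Artin relation thus reduces to its linear part. *)
Lemma affw_conj (c0 : R -> W) (w : word) :
  (forall l, l \in w -> forall r,
     rho l.1 (c l.1 (r - chi [:: l])) - c l.1 r = rho l.1 (c0 (r - chi [:: l])) - c0 r) ->
  forall f r, affw w f r = rhow w (f (r - chi w) + c0 (r - chi w)) - c0 r.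
Proof.
elim: w => [|l w IH] H f r; first by rewrite /= (chi_nil Hchi) subr0 addrK.
rewrite /= IH => [|k kw]; last by apply: H; rewrite inE kw orbT.
have Hl := H l (mem_head _ _) r.
rewrite raddfD -addrA Hl addrA -raddfD subrK.
by rewrite (chi_cons Hchi l w) opprD addrA.
Qed.

Hypothesis rhoK : forall v, involutive (rho v).

Lemma rhow_eq0 w x : rhow w x = 0 -> x = 0.
Proof.
elim: w => //= l w IH; rewrite -[RHS](raddf0 (rho l.1)).
by move/(can_inj (rhoK l.1)).
Qed.

Hypothesis aff_rel : forall u v, adj u v -> forall f r,
  affw (alt u v (lab u v)) f r = affw (alt v u (lab u v)) f r.

Lemma affw_eq w1 w2 : w1 =A w2 -> forall f, affw w1 f = affw w2 f.
Proof.
elim=> {w1 w2} [//|w1 w2 _ IH f|w1 w2 w3 _ IH1 _ IH2 f|a b v s f|a b u v uv f].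
- by rewrite IH.
- by rewrite IH1.
- rewrite !affw_cat; congr (affw a _); apply/funext => r /=.
  rewrite addrNK rhoK (chi_letterN Hchi) opprK.
  by rewrite subrK addrK.
- rewrite !affw_cat; congr (affw a _); apply/funext => r; exact: aff_rel.
Qed.

Lemma cocycle_eq w1 w2 : w1 =A w2 -> cocycle w1 = cocycle w2.
Proof. by move=> w12; apply: affw_eq. Qed.

Hypothesis c_lt0 : forall v r, r < 0 -> c v r = 0.

Lemma cocycle_bounded w : exists B, forall r, r < B -> cocycle w r = 0.
Proof.
elim: w => [|l w [B HB]]; first by exists 0.
exists (Order.min (Order.min 0 B + chi [:: l]) 0) => r.
rewrite lt_min => /andP[]; rewrite -ltrBlDr lt_min => /andP[r1 r2] r0.
by rewrite /cocycle /= c_lt0 // -/(cocycle w _) HB // (c_lt0 _ r0) addr0 raddf0 subrr.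
Qed.

(** The weights [z] are those of [d0], so that for [d] in the kernel of [d0] the first term of
    [coc_tuple_mulF] vanishes. *)
Definition coc_tuple n (z : 'I_n -> int) (x : 'I_n -> fsum) (r : R) : W :=
  \sum_(i < n) lin (cocycle^~ r) (x i) *~ z i.

Lemma coc_tuple_bounded n (z : 'I_n -> int) (x : 'I_n -> fsum) :
  exists B, forall r, r < B -> coc_tuple z x r = 0.
Proof.
have fin (I : Type) (s : seq I) (P : I -> R -> Prop) :
    (forall i, exists B, forall r, r < B -> P i r) ->
    exists B, forall r, r < B -> List.Forall (P^~ r) s.
  move=> Pex; elim: s => [|i s [B HB]]; first by exists 0 => r _; constructor.
  have [B' HB'] := Pex i; exists (Order.min B B') => r.
  by rewrite lt_min => /andP[rB rB']; constructor; [apply: HB'|apply: HB].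
have lin0 (d : fsum) : exists B, forall r, r < B -> lin (cocycle^~ r) d = 0.
  have [B HB] := fin _ d (fun p r => cocycle p.2 r = 0) (fun p => cocycle_bounded p.2).
  exists B => r /HB; rewrite /lin; elim: d {HB} => [|p d IH] H; first by rewrite big_nil.
  by inversion H as [|? ? H1 H2]; subst; rewrite big_cons H1 mul0rz add0r IH.
have [B HB] := fin _ (enum 'I_n) (fun i r => lin (cocycle^~ r) (x i) = 0) (fun i => lin0 (x i)).
exists B => r /HB /List.Forall_forall H; rewrite /coc_tuple big1 // => i _.
rewrite H ?mul0rz //.
have : i \in enum 'I_n by rewrite mem_enum.
elim: (enum 'I_n) => //= j s IH; rewrite inE => /orP[/eqP->|/IH]; by [left|right].
Qed.

(** The product rule of a derivation, as for Fox derivatives. *)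
Lemma lin_cocycle_mulF (y d : fsum) r : lin (cocycle^~ r) (mulF y d) =
  lin (cocycle^~ r) y *~ aug d +
  \sum_(p <- y) rhow p.2 (lin (cocycle^~ (r - chi p.2)) d) *~ p.1.
Proof.
rewrite lin_mulF /lin mulrz_suml -big_split /=; apply: eq_bigr => p _.
under eq_bigr do rewrite cocycle_cat mulrzDl.
rewrite big_split /= mulrzDl addrC; congr (_ + _); first by rewrite rhow_sumMz.
by rewrite -mulrz_sumr -/(aug d) mulrzAC.
Qed.

Lemma coc_tuple_mulF n (z : 'I_n -> int) (y : fsum) (d : 'I_n -> fsum) r :
  coc_tuple z (fun i => mulF y (d i)) r =
  lin (cocycle^~ r) y *~ (\sum_(i < n) aug (d i) * z i) +
  \sum_(p <- y) rhow p.2 (coc_tuple z d (r - chi p.2)) *~ p.1.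
Proof.
rewrite /coc_tuple; under eq_bigr do rewrite lin_cocycle_mulF mulrzDl.
rewrite big_split /=; congr (_ + _).
  by rewrite mulrz_sumr; apply: eq_bigr => i _; rewrite mulrzA.
under eq_bigr do rewrite mulrz_suml.
rewrite exchange_big; apply: eq_bigr => p _ /=.
rewrite rhow_sumMz mulrz_suml; apply: eq_bigr => i _; exact: mulrzAC.
Qed.

(* A presentation matrix has finitely many entries, so their cocycle values vanish below a common bound, and
   multiplying by elements of nonnegative height only moves supports up. *)
Lemma FP1_cocycle_bounded : FP1_trivial adj lab chi ->
  exists B, forall w, 0 <= chi w -> forall r, r < B -> cocycle w r = 0.
Proof.
case=> n [z [m [M [inM [surj exact]]]]].
have [e [ine auge]] := surj 1.
(* The [j]-th unit vector maps to the row [M j], which exactness puts into the kernel of [d0]. *)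
have M0 j : \sum_(i < n) aug (M j i) * z i = 0.
  apply/(exact (M j) (inM j)); exists (fun k => if k == j then [:: (1, [::])] else [::]); split.
    by move=> k; case: ifP => //= _; rewrite (chi_nil Hchi) lexx.
  move=> i g; rewrite !coef_lin lin_bigcat (bigD1 j) //= eqxx big1 ?addr0 => [|k /negPf->].
    by rewrite lin_mulF big_seq1 mulr1z.
  by rewrite lin_mulF big_nil.
have [B1 HB1] := coc_tuple_bounded z e.
have [B2 HB2] : exists B, forall j r, r < B -> coc_tuple z (M j) r = 0.
  elim: (m) M {exact inM M0} => [|k IH] M; first by exists 0; case.
  have [B HB] := IH (fun j => M (lift ord0 j)).
  have [B' HB'] := coc_tuple_bounded z (M ord0).
  exists (Order.min B B') => j r; rewrite lt_min => /andP[rB rB'].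
  by case: (unliftP ord0 j) => [j' ->|->]; [apply: HB|apply: HB'].
exists (Order.min B1 B2) => w w0 r; rewrite lt_min => /andP[r1 r2].
(* As [d0] sends [e] to 1, the tuple [(w - 1) e] lies in the kernel, and its cocycle is that of [w]
   up to terms coming from [e]. *)
pose x i := mulF [:: (1, w)] (e i) ++ negF (e i).
have inx i : inG chi (x i).
  rewrite /inG all_cat; apply/andP; split; last by have := ine i; rewrite /inG /negF all_map.
  apply/allP => p; rewrite /mulF /= cats0 => /mapP[q qe ->] /=.
  by rewrite (chi_cat Hchi) addr_ge0 // (allP (ine i)).
have augx : \sum_(i < n) aug (x i) * z i = 0.
  rewrite big1 // => i _; rewrite aug_lin lin_cat lin_neg -!aug_lin aug_mulF.
  by rewrite /aug big_seq1 mul1r subrr mul0r.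
have /(exact x inx)[y [iny yE]] := augx.
have xr : coc_tuple z x r = 0.
  transitivity (\sum_(j < m) coc_tuple z (fun i => mulF (y j) (M j i)) r).
    rewrite /coc_tuple exchange_big; apply: eq_bigr => i _ /=.
    rewrite (@lin_eqR _ adj lab _ (cocycle^~ r) _ _ _ (yE i)) => [|a b ab].
      by rewrite lin_bigcat mulrz_suml.
    by rewrite (cocycle_eq ab).
  rewrite big1 // => j _; rewrite coc_tuple_mulF M0 mulr0z add0r big_seq big1 // => p py.
  rewrite HB2 ?rhow0 ?mul0rz // (le_lt_trans _ r2) // lerBlDr lerDl.
  exact: (allP (iny j)).
have xE : coc_tuple z x r = coc_tuple z (fun i => mulF [:: (1, w)] (e i)) r - coc_tuple z e r.
  rewrite /coc_tuple -sumrB; apply: eq_bigr => i _.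
  by rewrite lin_cat lin_neg mulrzBl.
move: xr; rewrite xE coc_tuple_mulF auge (HB1 _ r1) subr0 mulr1z /lin !big_seq1 mulr1z /=.
by rewrite HB1 ?rhow0 ?mul0rz ?addr0 // (le_lt_trans _ r1) // lerBlDr lerDl.
Qed.

(* Conjugating [a] by [b^n] translates its cocycle by [- n * chi b], hence arbitrarily far down. *)
Lemma FP1_cocycle_eq0 (a b : V * bool) : FP1_trivial adj lab chi ->
  0 <= chi [:: a] -> 0 < chi [:: b] -> (forall r, c b.1 r = 0) ->
  forall r, cocycle [:: a] r = 0.
Proof.
move=> /FP1_cocycle_bounded[B HB] a0 b0 cb r.
have coc_nseq (s : bool) n r' : cocycle (nseq n (b.1, s)) r' = 0.
  elim: n r' => [//|n IH] r'.
  by rewrite /cocycle /= -/(cocycle _ _) IH !cb addr0 raddf0 subrr.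
have chi_nseq s n : chi (nseq n (b.1, s)) = chi [:: (b.1, s)] *+ n.
  elim: n => [|n IH]; first by rewrite (chi_nil Hchi).
  by rewrite mulrS -IH -(chi_cons Hchi _ (nseq n _)).
(* [n] is chosen to put [r - n * chi b] below [B]. *)
have [n Hn] : exists n : nat, (r - B) / chi [:: b] < n%:R.
  by exists (Num.truncn `|(r - B) / chi [:: b]|).+1; rewrite (le_lt_trans (ler_norm _)) // truncnS_gt.
pose bi := nseq n (b.1, ~~ b.2).
have bE : b = (b.1, b.2) by case: (b).
have chib : chi [:: (b.1, ~~ b.2)] = - chi [:: b] by rewrite (chi_letterN Hchi) -bE.
have := HB (bi ++ [:: a] ++ nseq n (b.1, b.2)) _ (r - chi [:: b] *+ n).
rewrite !(chi_cat Hchi) !chi_nseq chib -bE mulNrn addrC addrK => /(_ a0).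
(* Powers of [b] have zero cocycle, so only the injective [rhow bi] applied to the cocycle of [a]
   remains. *)
rewrite cocycle_cat coc_nseq addr0 cocycle_cat bE coc_nseq rhow0 add0r -bE.
rewrite chi_nseq chib mulNrn opprK subrK => H; apply: (@rhow_eq0 bi); apply: H.
by rewrite ltrBlDr -ltrBlDl -mulr_natl -ltr_pdivrMr.
Qed.

End Cocycle.

Lemma alt_double (V : finType) (u v : V) k :
  alt u v k.*2 = flatten (nseq k [:: (u, true); (v, true)]).
Proof. by elim: k => //= k ->. Qed.

(** * Connectedness: a cocycle modulo [p] supported on one component *)

Section Disconnected.
Variables (V : finType) (adj : rel V) (lab : V -> V -> nat) (R : realType).
Variables (chi : word V -> R) (Hchi : is_character adj lab chi).
Hypotheses (adj_sym : symmetric adj)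
  (lab_sym : forall u v, adj u v -> lab u v = lab v u).
Variables (p : nat) (p_pr : prime p)
  (p_dvd : forall u v, adj u v -> ~~ odd (lab u v) -> (2 < lab u v)%N ->
     (p %| (lab u v)./2)%N).

Let rho (_ : V) : {additive 'F_p -> 'F_p} := idfun.

Let comp (u v : V) (r : R) : 'F_p :=
  ((r == 0) && connect (liv_rel adj lab chi) u v)%:R.

Let rhow_id w x : rhow rho w x = x.
Proof. by elim: w. Qed.

Lemma dead_edge_sym u v : dead_edge adj lab chi u v = dead_edge adj lab chi v u.
Proof.
rewrite /dead_edge adj_sym; case vu: (adj v u) => //=.
by rewrite (lab_sym vu) addrC.
Qed.

Lemma liv_rel_sym : symmetric (liv_rel adj lab chi).
Proof.
move=> u v; rewrite /liv_rel adj_sym dead_edge_sym.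
by case: (living chi u) => //=; rewrite andbF.
Qed.

(* Across a dead edge the word [x y] acts as a translation, whose [m / 2]-th power is trivial modulo [p]. *)
Lemma affw_dead_edge u x y f r : dead_edge adj lab chi x y ->
  affw chi rho (comp u) (alt x y (lab x y)) f r = f r.
Proof.
case/and4P=> xy em m2 /eqP chi0; have := p_dvd xy em m2.
rewrite -[lab x y]odd_double_half (negPf em) add0n doubleK; move: (_./2) => k pk.
have chi_xy : chi [:: (x, true); (y, true)] = 0 by rewrite (chi_cons Hchi).
rewrite alt_double; set w := [:: _; _] in chi_xy *.
have -> : affw chi rho (comp u) (flatten (nseq k w)) f r =
    f r + cocycle chi rho (comp u) w r *+ k.
  elim: k {pk} r => [|k IH] r; first by rewrite addr0.
  rewrite -[flatten _]/(w ++ flatten (nseq k w)) affw_cat (affwE Hchi) rhow_id chi_xy subr0 IH.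
  by rewrite -addrA -mulrSr.
have /dvdnP[q ->] := pk.
by rewrite mulrnA -[_ *+ p]mulr_natr pchar_Fp_0 // mulr0 addr0.
Qed.

(** Off the dead edges a common [c0] exists: a dead end translates by 0, so its coboundary is 0 for
    any [c0], and two living ends lie in the same component. *)
Let aff_rel u x y : adj x y -> forall f r,
  affw chi rho (comp u) (alt x y (lab x y)) f r =
  affw chi rho (comp u) (alt y x (lab x y)) f r.
Proof.
move=> xy f r; have [de|nde] := boolP (dead_edge adj lab chi x y).
  rewrite affw_dead_edge // (lab_sym xy) affw_dead_edge //.
  by rewrite dead_edge_sym.
have inner v : (forall r, comp u x (r - chiv chi x) - comp u x r =
                  comp u v (r - chiv chi x) - comp u v r) ->
    (forall r, comp u y (r - chiv chi y) - comp u y r =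
                  comp u v (r - chiv chi y) - comp u v r) ->
    affw chi rho (comp u) (alt x y (lab x y)) f r =
    affw chi rho (comp u) (alt y x (lab x y)) f r.
  move=> Hx Hy; rewrite !(affw_conj Hchi (c0 := comp u v)).
  - by rewrite !rhow_id (chi_eq Hchi (a := alt x y _) (b := alt y x (lab x y))) //;
      have := ae_rel lab [::] [::] xy; rewrite /= !cats0.
  - by move=> l /mem_alt[]-> r' /=; [apply: Hy|apply: Hx].
  - by move=> l /mem_alt[]-> r' /=; [apply: Hx|apply: Hy].
have [livx|] := boolP (living chi x); last first.
  by rewrite /living negbK => /eqP x0; apply: (inner y) => // r'; rewrite x0 subr0 !subrr.
have [livy|] := boolP (living chi y); last first.
  by rewrite /living negbK => /eqP y0; apply: (inner x) => // r'; rewrite y0 subr0 !subrr.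
have xyc : connect (liv_rel adj lab chi) u x = connect (liv_rel adj lab chi) u y.
  apply: same_connect_r; first exact/sym_connect_sym/liv_rel_sym.
  by apply: connect1; rewrite /liv_rel livx livy xy.
by apply: (inner x) => // r'; rewrite /comp xyc.
Qed.

Lemma Liv_connected_of_Sigma1 : in_Sigma1 adj lab chi -> Liv_connected adj lab chi.
Proof.
move=> S1 u v livu livv; apply/negPn/negP => nuv.
have [su u0] := living_letter Hchi livu; have [sv v0] := living_letter Hchi livv.
have := FP1_cocycle_eq0 Hchi (rho := rho) (c := comp u) _ (aff_rel u) _ S1
  (a := (u, su)) (b := (v, sv)) (ltW u0) v0.
move=> /(_ (fun _ _ => erefl)) H.
have {}H := H _ _ 0; move: H.
(* At 0 the Dirac function shifted by the nonzero height of the letter vanishes, and subtracting the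
   unshifted one leaves -1. *)
rewrite /cocycle /= /comp !add0r eqxx oppr_eq0 (gt_eqF u0) connect0 /= add0r => H.
suff /eqP : (-1 : 'F_p) = 0 by rewrite oppr_eq0 oner_eq0.
apply: H => [w r r0|r]; first by rewrite (lt_eqF r0).
by rewrite (negPf nuv) andbF.
Qed.

End Disconnected.

(** * Braid relations between two reflections *)

Section TwoReflections.
Variables (K : fieldType) (U : lmodType K) (fu fv : U -> K) (hu hv : U).
Hypotheses (fuL : scalar fu) (fvL : scalar fv).
Let s x := x + fu x *: hu.
Let t x := x + fv x *: hv.

Fixpoint alt_comp (b : bool) n (x : U) : U :=
  if n is n'.+1 then (if b then s else t) (alt_comp (~~ b) n' x) else x.

Hypotheses (fuu : fu hu = -2) (fvv : fv hv = -2).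

Let fD (f : U -> K) (fL : scalar f) x y : f (x + y) = f x + f y.
Proof. by have := fL 1 x y; rewrite scale1r mul1r. Qed.
Let f0 (f : U -> K) (fL : scalar f) : f 0 = 0.
Proof. by apply: (addrI (f 0)); rewrite -fD // addr0 addr0. Qed.
Let fZ (f : U -> K) (fL : scalar f) a x : f (a *: x) = a * f x.
Proof. by have := fL a x 0; rewrite addr0 f0 // addr0. Qed.

Lemma alt_comp_linear b n a x y :
  alt_comp b n (a *: x + y) = a *: alt_comp b n x + alt_comp b n y.
Proof.
elim: n b => //= n IH b; rewrite IH; case: b; rewrite /s /t.
  by rewrite fD // fZ // scalerDl scalerDr scalerA !addrA; congr (_ + _); rewrite addrAC.
by rewrite fD // fZ // scalerDl scalerDr scalerA !addrA; congr (_ + _); rewrite addrAC.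
Qed.

Lemma alt_compZ b n a x : alt_comp b n (a *: x) = a *: alt_comp b n x.
Proof.
have H0 : alt_comp b n 0 = 0.
  have := alt_comp_linear b n 1 0 0; rewrite scaler0 addr0 scale1r => H.
  by apply: (addrI (alt_comp b n 0)); rewrite -H addr0.
by have := alt_comp_linear b n a x 0; rewrite H0 !addr0.
Qed.

Lemma alt_compD b n x y : alt_comp b n (x + y) = alt_comp b n x + alt_comp b n y.
Proof. by have := alt_comp_linear b n 1 x y; rewrite !scale1r. Qed.

(** Vanishing pairings make the reflections commute, which suffices for every even label, not only
    for 2. *)
Lemma alt_comp_even m x : fu hv = 0 -> fv hu = 0 -> ~~ odd m ->
  alt_comp true m x = alt_comp false m x.
Proof.
move=> uv vu em; rewrite -[m]odd_double_half (negPf em) add0n; move: (_./2) => k.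
have st y : s (t y) = t (s y).
  by rewrite /s /t !fD // !fZ // uv vu !mulr0 !addr0 addrAC.
by elim: k => //= k ->; rewrite st.
Qed.

(* In the basis below [t] swaps the two vectors and [s] swaps them up to [z ^+ 2], as in the dihedral group. *)
Lemma alt_comp_odd z m x : fu hv = z + z^-1 -> fv hu = z + z^-1 ->
  odd m -> z ^+ m = 1 -> z ^+ 2 != 1 ->
  alt_comp true m x = alt_comp false m x.
Proof.
move=> uv vu om zm z2.
have z0 : z != 0.
  apply: contra_eq_neq zm => ->; rewrite expr0n; case: (m) om => //= _ _.
  by rewrite eq_sym oner_eq0.
pose E1 := hu + z *: hv; pose E2 := hu + z^-1 *: hv.
have tE1 : t E1 = E2.
  rewrite /t /E1 /E2 !fD // !fZ // vu fvv -addrA -scalerDl; congr (_ + _ *: _); ring.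
have tE2 : t E2 = E1.
  rewrite /t /E1 /E2 !fD // !fZ // vu fvv -addrA -scalerDl; congr (_ + _ *: _); ring.
have sE1 : s E1 = z ^+ 2 *: E2.
  rewrite /s /E1 /E2 !fD // !fZ // uv fuu scalerDr scalerA addrAC -{1}[hu]scale1r -scalerDl.
  by congr (_ *: _ + _ *: _); field.
have sE2 : s E2 = z ^- 2 *: E1.
  rewrite /s /E1 /E2 !fD // !fZ // uv fuu scalerDr scalerA addrAC -{1}[hu]scale1r -scalerDl.
  by congr (_ *: _ + _ *: _); field.
have sZ a y : s (a *: y) = a *: s y by rewrite /s fZ // scalerDr scalerA.
have tZ a y : t (a *: y) = a *: t y by rewrite /t fZ // scalerDr scalerA.
have mE : m = m./2.*2.+1 by rewrite -{1}[m]odd_double_half om.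
(* This is [z ^+ m = 1] read through [4 * m./2 + 2 = 2 * m]; it makes the scalars of the two
   alternating products agree on [E1] and [E2]. *)
have zk : z ^+ 2 ^+ m./2 ^+ 2 = z ^- 2.
  apply: (mulIf (expf_neq0 2 z0)); rewrite mulVf ?expf_neq0 //.
  rewrite -!exprM -exprD (_ : _ + 2 = m * 2)%N; last by rewrite {2}mE -muln2 [RHS]mulSn addnC [in RHS]mulnC.
  by rewrite exprM zm expr1n.
have zk2 : z ^+ 2 * (z ^+ 2) ^+ m./2 = ((z ^+ 2) ^+ m./2)^-1.
  have nz : (z ^+ 2) ^+ m./2 != 0 by rewrite !expf_neq0.
  by apply: (mulIf nz); rewrite mulVf // -mulrA -expr2 zk mulfV // expf_neq0 // z0.
have tsE1 k : alt_comp false k.*2 E1 = (z ^+ 2) ^+ k *: E1.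
  elim: k => [|k IH]; first by rewrite scale1r.
  by rewrite doubleS [LHS]/= IH sZ tZ sE1 tZ tE2 scalerA (exprSr _ k).
have tsE2 k : alt_comp false k.*2 E2 = (z ^+ 2) ^- k *: E2.
  elim: k => [|k IH]; first by rewrite expr0 invr1 scale1r.
  by rewrite doubleS [LHS]/= IH sZ tZ sE2 tZ tE1 scalerA (exprSr _ k) invfM mulrC.
have stE1 k : alt_comp true k.*2 E1 = (z ^+ 2) ^- k *: E1.
  elim: k => [|k IH]; first by rewrite expr0 invr1 scale1r.
  by rewrite doubleS [LHS]/= IH tZ sZ tE1 sE2 scalerA (exprSr _ k) invfM mulrC.
have stE2 k : alt_comp true k.*2 E2 = (z ^+ 2) ^+ k *: E2.
  elim: k => [|k IH]; first by rewrite scale1r.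
  by rewrite doubleS [LHS]/= IH tZ sZ tE2 sE1 scalerA (exprSr _ k).
have eqE1 : alt_comp true m E1 = alt_comp false m E1.
  by rewrite mE /= tsE1 stE1 sZ tZ sE1 tE1 scalerA -zk2 mulrC.
have eqE2 : alt_comp true m E2 = alt_comp false m E2.
  by rewrite mE /= tsE2 stE2 sZ tZ sE2 tE2 scalerA -invfM mulrC zk2 invrK.
(* Hence [E1] and [E2] span [hu] and [hv]. *)
have zz : z - z^-1 != 0.
  apply: contra z2; rewrite subr_eq0 => /eqP zE; by rewrite expr2 {2}zE mulfV.
have eqv : alt_comp true m hv = alt_comp false m hv.
  apply: (scalerI zz); rewrite -!alt_compZ.
  have -> : (z - z^-1) *: hv = E1 + (-1) *: E2.
    by rewrite /E1 /E2 scaleN1r opprD addrACA subrr add0r scalerBl.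
  by rewrite !(alt_compD _ _ E1) !alt_compZ eqE1 eqE2.
have equ : alt_comp true m hu = alt_comp false m hu.
  have -> : hu = E1 + (- z) *: hv by rewrite /E1 scaleNr addrK.
  by rewrite !(alt_compD _ _ E1) !alt_compZ eqE1 eqv.
(* [q1] and [q2] solve the linear system [fu y = fv y = 0], of determinant [4 - a ^+ 2 = dt]; both
   reflections then fix [y]. *)
pose a := z + z^-1; pose dt := - (z - z^-1) ^+ 2.
have dt0 : dt != 0 by rewrite oppr_eq0 expf_neq0.
pose q1 := (2 * fu x + a * fv x) / dt; pose q2 := (a * fu x + 2 * fv x) / dt.
pose y := x + q1 *: hu + q2 *: hv.
have zz1 : z * z - 1 != 0 by rewrite subr_eq0 -expr2.
have yu : fu y = 0.
  by rewrite /y !fD // !fZ // fuu uv /q1 /q2 /dt /a; field; rewrite z0 oppr_eq0 expf_neq0.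
have yv : fv y = 0.
  by rewrite /y !fD // !fZ // fvv vu /q1 /q2 /dt /a; field; rewrite z0 oppr_eq0 expf_neq0.
have fixy b n : alt_comp b n y = y.
  by elim: n b => //= n IH b; rewrite IH; case: b; rewrite /s /t ?yu ?yv scale0r addr0.
have -> : x = y + ((- q1) *: hu + (- q2) *: hv).
  by rewrite /y !scaleNr -!addrA [q2 *: _ + _]addrCA subrr addr0 subrr addr0.
by rewrite !(alt_compD _ _ y) !fixy !alt_compD !alt_compZ equ eqv.
Qed.

End TwoReflections.

Definition prim_root_seq (m : nat) : algC :=
  if m is m'.+1 then sval (C_prim_root_exists (ltn0Sn m')) else 1.

Lemma prim_root_seqP m : (0 < m)%N -> m.-primitive_root (prim_root_seq m).
Proof. by case: m => // m _ /=; case: C_prim_root_exists. Qed.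

(** * A dual reflection representation of the Artin group *)

Section Reflections.
Variables (V : finType) (adj : rel V) (lab : V -> V -> nat).
Hypotheses (adj_sym : symmetric adj) (adj_irr : irreflexive adj)
  (lab_sym : forall u v, adj u v -> lab u v = lab v u)
  (lab_ge2 : forall u v, adj u v -> (2 <= lab u v)%N).
Local Notation W := {ffun V -> algC^o}.

(** The entry for an odd label [m] is twice the cosine of a multiple of [2 pi / m]; even labels get
    0, which makes those reflections commute. *)
Definition coroot (v : V) : W := [ffun u =>
  if u == v then -2 else
  if adj u v && odd (lab u v) then prim_root_seq (lab u v) + (prim_root_seq (lab u v))^-1 else 0].

(** The vertex [v] acts through evaluation at [v], so it fixes every function vanishing there; this
    keeps the values of [delta v0] fixed by the other reflections. *)
Definition reflection (v : V) (x : W) : W := x + x v *: coroot v.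

Fact reflection_is_additive v : zmod_morphism (reflection v).
Proof.
move=> x y; rewrite /reflection !ffunE scalerBl opprD !addrA; congr (_ + _).
by rewrite addrAC.
Qed.
HB.instance Definition _ v := GRing.isZmodMorphism.Build W W (reflection v) (reflection_is_additive v).

Definition reflectionA (v : V) : {additive W -> W} := reflection v.

Lemma reflectionK v : involutive (reflection v).
Proof.
move=> x; apply/ffunP => u; rewrite /reflection !ffunE eqxx /GRing.scale /=; ring.
Qed.

Let ev_scalar u : scalar (fun x : W => (x u : algC)).
Proof. by move=> a x y; rewrite !ffunE. Qed.

Let rhow_alt u v b n x :
  rhow reflectionA (if b then alt u v n else alt v u n) x =
  alt_comp (fun x : W => x u) (fun x : W => x v) (coroot u) (coroot v) b n x.
Proof. by elim: n b => [|n IH] []; rewrite //= -IH. Qed.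

Lemma reflection_braid u v : adj u v -> forall x,
  rhow reflectionA (alt u v (lab u v)) x = rhow reflectionA (alt v u (lab u v)) x.
Proof.
move=> uv x; have nuv : (u == v) = false by apply: contraTF uv => /eqP->; rewrite adj_irr.
have vu : adj v u by rewrite adj_sym.
rewrite (rhow_alt u v true) (rhow_alt u v false).
have cuu w : coroot w w = -2 by rewrite ffunE eqxx.
have [om|em] := boolP (odd (lab u v)); last first.
  apply: (alt_comp_even (ev_scalar u) (ev_scalar v)) => //; rewrite ffunE; first by rewrite nuv uv (negPf em).
  by rewrite eq_sym nuv vu -(lab_sym uv) (negPf em).
have pz := prim_root_seqP (ltnW (lab_ge2 uv)).
apply: (@alt_comp_odd _ _ _ _ _ _ (ev_scalar u) (ev_scalar v) (cuu u) (cuu v) (prim_root_seq (lab u v))) => //.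
- by rewrite ffunE nuv uv om.
- by rewrite ffunE eq_sym nuv vu -(lab_sym uv) om.
- exact: prim_expr_order pz.
(* An odd label, being at least 2, does not divide 2. *)
rewrite -(prim_order_dvd pz); apply: contraL om => /(dvdn_leq (m := 2) isT) le2.
by have /anti_leq -> : (lab u v <= 2 <= lab u v)%N by rewrite le2 lab_ge2.
Qed.

End Reflections.

(** * Dominance: a dead vertex without living neighbours *)

Section NotDominant.
Variables (V : finType) (adj : rel V) (lab : V -> V -> nat) (R : realType).
Variables (chi : word V -> R) (Hchi : is_character adj lab chi).
Hypotheses (adj_sym : symmetric adj) (adj_irr : irreflexive adj)
  (lab_sym : forall u v, adj u v -> lab u v = lab v u)
  (lab_ge2 : forall u v, adj u v -> (2 <= lab u v)%N).
Variables (v0 : V) (dead0 : ~~ living chi v0)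
  (dead_nbr : forall u, adj v0 u -> ~~ living chi u).
Local Notation W := {ffun V -> algC^o}.

Let delta (v : V) (r : R) : W := [ffun u => ((v == v0) && (r == 0) && (u == v0))%:R].

Let rho := reflectionA adj lab.

(* [delta v0] is fixed by every generator other than [v0], so on each edge the cocycle is 0 or the coboundary of
   [delta v0]. *)
Let aff_rel x y : adj x y -> forall f r,
  affw chi rho delta (alt x y (lab x y)) f r = affw chi rho delta (alt y x (lab x y)) f r.
Proof.
move=> xy f r; pose c0 := if (x == v0) || (y == v0) then delta v0 else fun=> 0.
have delta_n v r' : v != v0 -> delta v r' = 0.
  by move=> vv0; apply/ffunP => u; rewrite !ffunE (negPf vv0).
have inner v : v = x \/ v = y -> forall r',
    rho v (delta v (r' - chi [:: (v, true)])) - delta v r' =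
    rho v (c0 (r' - chi [:: (v, true)])) - c0 r'.
  move=> vxy r'; have [E|vv0] := eqVneq v v0.
    by rewrite /c0; case: vxy E => <- ->; rewrite eqxx ?orbT.
  rewrite !(delta_n v) // raddf0 subr0 /c0; case: ifP => xy0; last by rewrite raddf0 subr0.
  (* A neighbour [v] of [v0] is dead, so it does not translate, and its reflection fixes the values
     of [delta v0], which vanish at [v]. *)
  have v0v : adj v0 v.
    by case: vxy vv0 => ->; case/orP: xy0 => /eqP <-; rewrite ?eqxx // adj_sym.
  have /negPn/eqP chiv0 := dead_nbr v0v.
  rewrite -/(chiv chi v) chiv0 subr0 /rho /= /reflection.
  have -> : delta v0 r' v = 0 by rewrite ffunE (negPf vv0) andbF.
  by rewrite scale0r addr0 subrr.
rewrite !(affw_conj Hchi (c0 := c0)).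
- rewrite /rho reflection_braid // (chi_eq Hchi (a := alt x y _) (b := alt y x (lab x y))) //.
  by have := ae_rel lab [::] [::] xy; rewrite /= !cats0.
- by move=> l /mem_alt[]-> r' /=; apply: inner; [right|left].
- by move=> l /mem_alt[]-> r' /=; apply: inner; [left|right].
Qed.

Lemma not_Sigma1_of_not_dominant : (exists w, chi w != 0) -> ~ in_Sigma1 adj lab chi.
Proof.
move=> /(exists_living Hchi)[b livb] S1; have [s b0] := living_letter Hchi livb.
have /eqP chi0 : chi [:: (v0, true)] == 0 by move: dead0; rewrite negbK.
have bv0 : b != v0 by apply: contraTneq livb => ->.
have := @FP1_cocycle_eq0 _ _ _ _ _ Hchi _ rho delta (reflectionK adj lab) aff_rel _
  (v0, true) (b, s) S1 _ b0 _ 0.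
rewrite /cocycle /= chi0 subrr !add0r => H.
have {H} : rho v0 (delta v0 0) - delta v0 0 = 0.
  apply: H => [v r r0||r]; [|exact: lexx|].
    by apply/ffunP => u; rewrite !ffunE (lt_eqF r0) andbF.
  by apply/ffunP => u; rewrite !ffunE (negPf bv0).
(* The difference is [coroot v0], whose coordinate at [v0] is -2. *)
move/ffunP/(_ v0); rewrite /rho /= /reflection !ffunE !eqxx /= addrC addrA addNr add0r.
by move/eqP; rewrite scale1r oppr_eq0 pnatr_eq0.
Qed.

End NotDominant.

Theorem theorem1p3 (V : finType) (adj : rel V) (lab : V -> V -> nat)
  (R : realType)
  (adj_sym : symmetric adj) (adj_irr : irreflexive adj)
  (lab_sym : forall u v, adj u v -> lab u v = lab v u)
  (lab_ge2 : forall u v, adj u v -> (2 <= lab u v)%N)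
  (Hp : exists p : nat, prime p /\
         forall u v, adj u v -> ~~ odd (lab u v) -> (2 < lab u v)%N ->
           (p %| (lab u v)./2)%N)
  (chi : word V -> R) (Hchi : is_character adj lab chi)
  (Hnz : exists w, chi w != 0) :
  in_Sigma1 adj lab chi <->
  Liv_connected adj lab chi /\ Liv_dominant adj chi.
Proof.
split=> [S1|[conn dom]]; last exact: Sigma1_of_Liv.
have [p [p_pr p_dvd]] := Hp.
split; first exact: Liv_connected_of_Sigma1 p_dvd S1.
move=> v deadv; apply: contrapT => isolated.
apply: (not_Sigma1_of_not_dominant Hchi adj_sym adj_irr lab_sym lab_ge2 (v0 := v)) S1 => //.
by move=> u vu; apply/negP => livu; apply: isolated; exists u; rewrite livu.
Qed.
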